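(* Let $T$ be the $\omega$-Kalmbach monad on the category $\mathbf{BPos}$ of bounded posets. The real unit interval $[0,1]$ (with its usual order, partial addition, complement $a\mapsto 1-a$ and multiplication) is, up to isomorphism, the unique non-initial, non-final, irreducible monoid in the Eilenberg-Moore category $\mathbf{BPos}^T$.
   Context: **Bounded posets.** A poset is bounded when it has a minimum $0$ and a maximum $1$. $\mathbf{BPos}$ is the category of bounded posets and order-preserving maps preserving $0$ and $1$. A bounded poset is $\omega$-complete when every increasing sequence $a_1\leq a_2\leq\cdots$ has a supremum. A monotone map $f$ between $\omega$-complete bounded posets is $\omega$-normal when $f(\bigvee_i x_i)=\bigvee_i f(x_i)$ for every increasing sequence $x_1\leq x_2\leq\cdots$. **Effect algebras.** An effect algebra is a set $E$ with an element $0$, a partial binary operation $\oplus$ and a total unary operation $(\ )^\perp$ such that, writing $a\perp b$ when $a\oplus b$ is defined and $1:=0^\perp$: (i) if $a\perp b$ then $b\perp a$ and $a\oplus b=b\oplus a$; (ii) $a\perp 0$ and $a\oplus 0=a$; (iii) if $a\perp b$ and $(a\oplus b)\perp c$ then $b\perp c$, $a\perp(b\oplus c)$ and $(a\oplus b)\oplus c=a\oplus(b\oplus c)$; (iv) $a^\perp$ is the unique element with $a\oplus a^\perp=1$; (v) if $a\perp 1$ then $a=0$. It is a bounded poset under $a\leq b$ iff $a\oplus c=b$ for some $c$. A homomorphism is a map $f$ with $f(1)=1$ such that $a\perp b$ implies $f(a)\perp f(b)$ and $f(a\oplus b)=f(a)\oplus f(b)$. **The category and the monad.** $\omega\mathbf{EA}$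 has as objects the effect algebras whose underlying bounded poset is $\omega$-complete, and as morphisms the effect algebra homomorphisms that are $\omega$-normal. The forgetful functor $U:\omega\mathbf{EA}\to\mathbf{BPos}$ has a left adjoint $K_\omega$ (the $\omega$-Kalmbach extension), and $T:=U\circ K_\omega$ is the $\omega$-Kalmbach monad. The category $\mathbf{BPos}^T$ is equivalent to $\omega\mathbf{EA}$, and monoids in $\mathbf{BPos}^T$ are understood through this equivalence. **Monoids.** The tensor product of $\omega\mathbf{EA}$ is the universal target of bimorphisms, i.e. maps $f:E\times F\to G$ with $f(1,1)=1$ that preserve defined sums (including definedness) and suprema of increasing sequences in each variable separately. The monoids for this tensor product are identified with the $\omega$-complete effect monoids. Here an effect monoid is an effect algebra $M$ with a total binary operation $\cdot$ that is associative, satisfies $x\cdot 1=x=1\cdot x$, and is such that $y\perp z$ implies $x\cdot y\perp x\cdot z$, $y\cdot x\perp z\cdot x$, $x\cdot(y\oplus z)=(x\cdot y)\oplus(x\cdot z)$ and $(y\oplus z)\cdot x=(y\cdot x)\oplus(z\cdot x)$. (It is known that the multiplication of an $\omega$-complete effect monoid automatically preserves suprema of increasing sequences in each variable.) Isomorphism means isomorphism of effect monoids. A monoid $M$ is irreducible when $M\cong M_1\times M_2$ (Cartesian product of monoids, pointwise operations) implies that $M_1$ or $M_2$ is final. The final object is $\{0\}$ and the initial object is $\{0,1\}$. **Unit interval.** On $[0,1]$: $a\perp b$ iff $a\leq 1-b$, $a\oplus b=a+b$, $a^\perp=1-a$, and $\cdot$ is the usual multiplication. *)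

(* Defs.v *)
(* MathComp / MathComp-Analysis; the reals are an arbitrary [R : realType]. *)
From HB Require Import structures.
From mathcomp Require Import all_boot all_order all_algebra.
From mathcomp Require Import boolp classical_sets reals ring lra.

Set Implicit Arguments.
Unset Strict Implicit.
Unset Printing Implicit Defensive.

Import Order.TTheory GRing.Theory Num.Theory.

Declare Scope effect_scope.
Delimit Scope effect_scope with EA.
Local Open Scope effect_scope.

(* The partial operation is a domain relation [orth] together with a total
   function [oplus] whose value is irrelevant outside the domain: every use of
   [oplus a b] below is guarded by [orth a b]. *)
HB.mixin Record isEffectAlgebra (E : Type) := {
  ezero : E ;
  orth : E -> E -> Prop ;
  oplus : E -> E -> E ;
  ocompl : E -> E ;
  oplus_comm : forall a b, orth a b -> orth b a /\ oplus a b = oplus b a ;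
  oplus_zero : forall a, orth a ezero /\ oplus a ezero = a ;
  oplus_assoc : forall a b c, orth a b -> orth (oplus a b) c ->
    [/\ orth b c, orth a (oplus b c) &
        oplus (oplus a b) c = oplus a (oplus b c)] ;
  ocompl_sum : forall a, orth a (ocompl a) /\
    oplus a (ocompl a) = ocompl ezero ;
  ocompl_unique : forall a b, orth a b -> oplus a b = ocompl ezero ->
    b = ocompl a ;
  orth_one : forall a, orth a (ocompl ezero) -> a = ezero
}.

#[short(type="effectAlgebraType")]
HB.structure Definition EffectAlgebra := { E of isEffectAlgebra E }.

Definition eone {E : effectAlgebraType} : E := ocompl ezero.

Notation "0" := ezero : effect_scope.
Notation "1" := eone : effect_scope.
Notation "a ⊥ b" := (orth a b) (at level 70, no associativity) : effect_scope.
Notation "a ⊕ b" := (oplus a b) (at level 50, left associativity)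
  : effect_scope.

Definition ele {E : effectAlgebraType} (a b : E) : Prop :=
  exists c : E, a ⊥ c /\ a ⊕ c = b.

Notation "a ≼ b" := (ele a b) (at level 70, no associativity) : effect_scope.

Definition increasing {E : effectAlgebraType} (u : nat -> E) : Prop :=
  forall n, u n ≼ u n.+1.

Definition is_supremum {E : effectAlgebraType} (u : nat -> E) (s : E) : Prop :=
  (forall n, u n ≼ s) /\ (forall b, (forall n, u n ≼ b) -> s ≼ b).

HB.mixin Record isOmegaComplete E of EffectAlgebra E := {
  omega_complete : forall u : nat -> E, increasing u ->
    exists s, is_supremum u s
}.

HB.mixin Record isEffectMonoid M of EffectAlgebra M := {
  emul : M -> M -> M ;
  emulA : forall x y z, emul x (emul y z) = emul (emul x y) z ;
  emulx1 : forall x, emul x 1 = x ;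
  emul1x : forall x, emul 1 x = x ;
  emulDr : forall x y z : M, y ⊥ z ->
    emul x y ⊥ emul x z /\ emul x (y ⊕ z) = emul x y ⊕ emul x z ;
  emulDl : forall x y z : M, y ⊥ z ->
    emul y x ⊥ emul z x /\ emul (y ⊕ z) x = emul y x ⊕ emul z x
}.

#[short(type="omegaEffectAlgebraType")]
HB.structure Definition OmegaEffectAlgebra :=
  { E of EffectAlgebra E & isOmegaComplete E }.

#[short(type="effectMonoidType")]
HB.structure Definition EffectMonoid :=
  { M of EffectAlgebra M & isEffectMonoid M }.

(* The Eilenberg-Moore category of the omega-Kalmbach monad is equivalent to
   omega-complete effect algebras with omega-normal homomorphisms; under this
   equivalence, monoids for the tensor product are the structures below.
   Preservation of suprema by the multiplication is not required: it follows
   from the other axioms. *)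
#[short(type="omegaEffectMonoidType")]
HB.structure Definition OmegaEffectMonoid :=
  { M of OmegaEffectAlgebra M & EffectMonoid M }.

Notation "x ⊙ y" := (emul x y) (at level 40, left associativity)
  : effect_scope.

Definition is_ea_hom (E F : effectAlgebraType) (f : E -> F) : Prop :=
  f 1 = 1 /\ (forall a b, a ⊥ b -> f a ⊥ f b /\ f (a ⊕ b) = f a ⊕ f b).

Definition omega_normal (E F : effectAlgebraType) (f : E -> F) : Prop :=
  forall (u : nat -> E) (s : E), increasing u -> is_supremum u s ->
    is_supremum (fun n => f (u n)) (f s).

Definition is_emonoid_hom (M N : effectMonoidType) (f : M -> N) : Prop :=
  is_ea_hom f /\ (forall x y, f (x ⊙ y) = f x ⊙ f y).

Definition is_omega_emonoid_hom (M N : omegaEffectMonoidType) (f : M -> N) :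
    Prop :=
  is_emonoid_hom f /\ omega_normal f.

Definition emonoid_iso (M N : effectMonoidType) : Prop :=
  exists (f : M -> N) (g : N -> M),
    [/\ is_emonoid_hom f, is_emonoid_hom g, cancel f g & cancel g f].

(* Initiality and finality are in the category of omega-complete effect
   monoids; see [bool_initial] and [unit_final] for the representatives. *)
Definition is_initial (M : omegaEffectMonoidType) : Prop :=
  forall N : omegaEffectMonoidType,
    exists! f : M -> N, is_omega_emonoid_hom f.

Definition is_final (M : omegaEffectMonoidType) : Prop :=
  forall N : omegaEffectMonoidType,
    exists! f : N -> M, is_omega_emonoid_hom f.

Section Product.
Variables E F : effectAlgebraType.

Let porth (a b : E * F) := a.1 ⊥ b.1 /\ a.2 ⊥ b.2.
Let poplus (a b : E * F) := (a.1 ⊕ b.1, a.2 ⊕ b.2).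
Let pocompl (a : E * F) := (ocompl a.1, ocompl a.2).
Let pzero : E * F := (0, 0).

Let poplus_comm a b : porth a b -> porth b a /\ poplus a b = poplus b a.
Proof.
move=> [/oplus_comm [h1 e1] /oplus_comm [h2 e2]]; split; first by split.
by rewrite /poplus e1 e2.
Qed.

Let poplus_zero a : porth a pzero /\ poplus a pzero = a.
Proof.
case: a => a1 a2; have [h1 e1] := oplus_zero a1; have [h2 e2] := oplus_zero a2.
by split; [split | rewrite /poplus /= e1 e2].
Qed.

Let poplus_assoc a b c : porth a b -> porth (poplus a b) c ->
  [/\ porth b c, porth a (poplus b c) &
      poplus (poplus a b) c = poplus a (poplus b c)].
Proof.
move=> [h1 h2] [/= k1 k2].
have [b1 c1 e1] := oplus_assoc _ _ _ h1 k1; have [b2 c2 e2] := oplus_assoc _ _ _ h2 k2.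
by split; [split | split | rewrite /poplus /= e1 e2].
Qed.

Let pocompl_sum a : porth a (pocompl a) /\ poplus a (pocompl a) = pocompl pzero.
Proof.
case: a => a1 a2; have [h1 e1] := ocompl_sum a1; have [h2 e2] := ocompl_sum a2.
by split; [split | rewrite /poplus /= e1 e2].
Qed.

Let pocompl_unique a b : porth a b -> poplus a b = pocompl pzero ->
  b = pocompl a.
Proof.
case: a b => [a1 a2] [b1 b2] [/= h1 h2] [e1 e2].
by rewrite /pocompl /= (ocompl_unique _ _ h1 e1) (ocompl_unique _ _ h2 e2).
Qed.

Let porth_one a : porth a (pocompl pzero) -> a = pzero.
Proof. by case: a => a1 a2 [/= /orth_one -> /orth_one ->]. Qed.

HB.instance Definition _ := isEffectAlgebra.Build (E * F)%type
  poplus_comm poplus_zero poplus_assoc pocompl_sum pocompl_unique porth_one.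

Lemma ele_prod (a b : E * F) : a ≼ b <-> a.1 ≼ b.1 /\ a.2 ≼ b.2.
Proof.
case: a b => [a1 a2] [b1 b2]; split.
  by move=> [[c1 c2] [[/= h1 h2] [e1 e2]]]; split; [exists c1 | exists c2].
move=> [[c1 /= [h1 e1]] [c2 /= [h2 e2]]]; exists (c1, c2).
by split; [split | rewrite -e1 -e2].
Qed.

End Product.

Section OmegaProduct.
Variables E F : omegaEffectAlgebraType.

Let prod_omega_complete (u : nat -> E * F) : increasing u ->
  exists s, is_supremum u s.
Proof.
move=> uI.
have [|s [us sl]] := @omega_complete E (fun n => (u n).1).
  by move=> n; have [] := (ele_prod _ _).1 (uI n).
have [|t [ut tl]] := @omega_complete F (fun n => (u n).2).
  by move=> n; have [] := (ele_prod _ _).1 (uI n).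
exists (s, t); split=> [n|b ub]; apply/ele_prod; split=> //=.
  by apply: sl => n; have [] := (ele_prod _ _).1 (ub n).
by apply: tl => n; have [] := (ele_prod _ _).1 (ub n).
Qed.

HB.instance Definition _ := isOmegaComplete.Build (E * F)%type
  prod_omega_complete.

End OmegaProduct.

Section MonoidProduct.
Variables M N : effectMonoidType.

Let pmul (x y : M * N) := (x.1 ⊙ y.1, x.2 ⊙ y.2).

Let pmulA x y z : pmul x (pmul y z) = pmul (pmul x y) z.
Proof. by rewrite /pmul /= !emulA. Qed.

Let pmulx1 x : pmul x 1 = x.
Proof. by case: x => a b; congr (_, _); apply: emulx1. Qed.

Let pmul1x x : pmul 1 x = x.
Proof. by case: x => a b; congr (_, _); apply: emul1x. Qed.

Let pmulDr x y z : y ⊥ z ->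
  pmul x y ⊥ pmul x z /\ pmul x (y ⊕ z) = pmul x y ⊕ pmul x z.
Proof.
move=> [/(emulDr x.1) [h1 e1] /(emulDr x.2) [h2 e2]].
by split; [split | congr (_, _)].
Qed.

Let pmulDl x y z : y ⊥ z ->
  pmul y x ⊥ pmul z x /\ pmul (y ⊕ z) x = pmul y x ⊕ pmul z x.
Proof.
move=> [/(emulDl x.1) [h1 e1] /(emulDl x.2) [h2 e2]].
by split; [split | congr (_, _)].
Qed.

HB.instance Definition _ := isEffectMonoid.Build (M * N)%type
  pmulA pmulx1 pmul1x pmulDr pmulDl.

End MonoidProduct.

HB.instance Definition _ (M N : omegaEffectMonoidType) :=
  EffectMonoid.on (M * N)%type.

Definition is_irreducible (M : omegaEffectMonoidType) : Prop :=
  forall M1 M2 : omegaEffectMonoidType,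
    emonoid_iso M (M1 * M2)%type -> is_final M1 \/ is_final M2.

Record unitI (R : realType) := UnitI {
  unitI_val : R ;
  unitI_bound : (0 <= unitI_val <= 1)%R
}.

Section UnitInterval.
Variable R : realType.
Local Open Scope ring_scope.

HB.instance Definition _ := [isSub for @unitI_val R].
HB.instance Definition _ := [Choice of unitI R by <:].

Implicit Types a b c : unitI R.
Local Notation v := (@unitI_val R).

Lemma unitI_inj : injective v. Proof. exact: val_inj. Qed.

Let inI (x : R) : Prop := 0 <= x <= 1.

Let zeroI : inI 0. Proof. by rewrite /inI lexx ler01. Qed.

Let complI a : inI (1 - v a).
Proof. by have /andP[a0 a1] := unitI_bound a; apply/andP; split; lra. Qed.

Let mulI a b : inI (v a * v b).
Proof.
have /andP[a0 a1] := unitI_bound a; have /andP[b0 b1] := unitI_bound b.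
by rewrite /inI mulr_ge0 // mulr_ile1.
Qed.

Definition unitI_zero : unitI R := UnitI zeroI.
Definition unitI_orth a b : Prop := v a <= 1 - v b.
(* [insubd] returns the default [unitI_zero] when the sum exceeds 1. *)
Definition unitI_oplus a b : unitI R := insubd unitI_zero (v a + v b).
Definition unitI_ocompl a : unitI R := UnitI (complI a).
Definition unitI_mul a b : unitI R := UnitI (mulI a b).

Lemma unitI_oplusE a b : unitI_orth a b ->
  v (unitI_oplus a b) = v a + v b.
Proof.
rewrite /unitI_orth => ab; rewrite -[LHS]/(val _) val_insubd.
have /andP[a0 a1] := unitI_bound a; have /andP[b0 b1] := unitI_bound b.
by rewrite ifT //; apply/andP; split; lra.
Qed.

Let Icomm a b : unitI_orth a b ->
  unitI_orth b a /\ unitI_oplus a b = unitI_oplus b a.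
Proof.
move=> ab; have ba : unitI_orth b a by move: ab; rewrite /unitI_orth; lra.
by split=> //; apply: unitI_inj; rewrite !unitI_oplusE // addrC.
Qed.

Let Izero a : unitI_orth a unitI_zero /\ unitI_oplus a unitI_zero = a.
Proof.
have h : unitI_orth a unitI_zero.
  by rewrite /unitI_orth /= subr0; have /andP[] := unitI_bound a.
by split=> //; apply: unitI_inj; rewrite unitI_oplusE //= addr0.
Qed.

Let Iassoc a b c : unitI_orth a b -> unitI_orth (unitI_oplus a b) c ->
  [/\ unitI_orth b c, unitI_orth a (unitI_oplus b c) &
      unitI_oplus (unitI_oplus a b) c = unitI_oplus a (unitI_oplus b c)].
Proof.
move=> ab abc; have := abc; rewrite {1}/unitI_orth unitI_oplusE // => h.
have /andP[a0 a1] := unitI_bound a.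
have bc : unitI_orth b c by rewrite /unitI_orth; lra.
have a_bc : unitI_orth a (unitI_oplus b c).
  by rewrite /unitI_orth unitI_oplusE //; lra.
by split=> //; apply: unitI_inj; rewrite !unitI_oplusE // addrA.
Qed.

Let Icompl a : unitI_orth a (unitI_ocompl a) /\
  unitI_oplus a (unitI_ocompl a) = unitI_ocompl unitI_zero.
Proof.
have h : unitI_orth a (unitI_ocompl a) by rewrite /unitI_orth /=; lra.
by split=> //; apply: unitI_inj; rewrite unitI_oplusE //=; lra.
Qed.

Let Iunique a b : unitI_orth a b ->
  unitI_oplus a b = unitI_ocompl unitI_zero -> b = unitI_ocompl a.
Proof.
move=> ab /(congr1 v); rewrite unitI_oplusE //= => e.
by apply: unitI_inj => /=; lra.
Qed.

Let Iorth1 a : unitI_orth a (unitI_ocompl unitI_zero) -> a = unitI_zero.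
Proof.
rewrite /unitI_orth /= => h; have /andP[a0 a1] := unitI_bound a.
by apply: unitI_inj => /=; lra.
Qed.

HB.instance Definition _ := isEffectAlgebra.Build (unitI R)
  Icomm Izero Iassoc Icompl Iunique Iorth1.

Lemma unitI_eleE a b : (a ≼ b)%EA <-> v a <= v b.
Proof.
have /andP[a0 a1] := unitI_bound a; have /andP[b0 b1] := unitI_bound b; split.
  move=> [c [h <-]]; rewrite [X in _ <= X]unitI_oplusE //.
  by have /andP[] := unitI_bound c; lra.
move=> ab; have cI : 0 <= v b - v a <= 1 by apply/andP; split; lra.
have h : unitI_orth a (UnitI cI) by rewrite /unitI_orth /=; lra.
exists (UnitI cI); split=> //.
by apply: unitI_inj; rewrite [LHS]unitI_oplusE //= addrC subrK.
Qed.

Let Iomega (u : nat -> unitI R) : increasing u -> exists s, is_supremum u s.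
Proof.
move=> _; pose A := range (fun n => v (u n)).
have A1 : ubound A 1%R by move=> _ [n _ <-]; have /andP[] := unitI_bound (u n).
have hA : has_sup A by split; [exists (v (u 0%N)), 0%N | exists 1%R].
have uA n : v (u n) <= sup A by apply: ub_le_sup; [case: hA | exists n].
have sI : 0 <= sup A <= 1.
  rewrite ge_sup //; last by case: hA.
  by rewrite andbT (le_trans _ (uA 0%N)) //; have /andP[] := unitI_bound (u 0%N).
exists (UnitI sI); split=> [n|b ub]; apply/unitI_eleE => //=.
by apply: ge_sup; [case: hA | move=> _ [n _ <-]; apply/unitI_eleE].
Qed.

HB.instance Definition _ := isOmegaComplete.Build (unitI R) Iomega.

Let ImulA a b c : unitI_mul a (unitI_mul b c) = unitI_mul (unitI_mul a b) c.
Proof. by apply: unitI_inj; rewrite /= mulrA. Qed.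

Let Imulx1 a : unitI_mul a 1%EA = a.
Proof. by apply: unitI_inj; rewrite /= subr0 mulr1. Qed.

Let Imul1x a : unitI_mul 1%EA a = a.
Proof. by apply: unitI_inj; rewrite /= subr0 mul1r. Qed.

Let ImulDr a b c : (b ⊥ c)%EA -> (unitI_mul a b ⊥ unitI_mul a c)%EA /\
  unitI_mul a (b ⊕ c)%EA = (unitI_mul a b ⊕ unitI_mul a c)%EA.
Proof.
move=> bc; have /andP[a0 a1] := unitI_bound a; have /andP[b0 b1] := unitI_bound b.
have h : unitI_orth (unitI_mul a b) (unitI_mul a c).
  have bc1 : v b + v c <= 1 by move: (bc : v b <= 1 - v c); lra.
  have : v a * (v b + v c) <= 1.
    by apply: mulr_ile1 => //; have /andP[] := unitI_bound c; lra.
  by rewrite /unitI_orth /=; lra.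
split=> //; apply: unitI_inj.
by rewrite [RHS]unitI_oplusE //= -mulrDr -unitI_oplusE.
Qed.

Let ImulDl a b c : (b ⊥ c)%EA -> (unitI_mul b a ⊥ unitI_mul c a)%EA /\
  unitI_mul (b ⊕ c)%EA a = (unitI_mul b a ⊕ unitI_mul c a)%EA.
Proof.
have mC x y : unitI_mul x y = unitI_mul y x.
  by apply: unitI_inj; rewrite /= mulrC.
by rewrite !(mC _ a); apply: ImulDr.
Qed.

HB.instance Definition _ := isEffectMonoid.Build (unitI R)
  ImulA Imulx1 Imul1x ImulDr ImulDl.

End UnitInterval.

Section TrivialMonoid.

Let uorth (a b : unit) : Prop := True.
Let uoplus (a b : unit) : unit := tt.
Let uocompl (a : unit) : unit := tt.

Let ucomm a b : uorth a b -> uorth b a /\ uoplus a b = uoplus b a.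
Proof. by []. Qed.

Let uzero a : uorth a tt /\ uoplus a tt = a.
Proof. by case: a. Qed.

Let uassoc a b c : uorth a b -> uorth (uoplus a b) c ->
  [/\ uorth b c, uorth a (uoplus b c) &
      uoplus (uoplus a b) c = uoplus a (uoplus b c)].
Proof. by []. Qed.

Let ucompl a : uorth a (uocompl a) /\ uoplus a (uocompl a) = uocompl tt.
Proof. by []. Qed.

Let uunique a b : uorth a b -> uoplus a b = uocompl tt -> b = uocompl a.
Proof. by case: b. Qed.

Let uorth1 a : uorth a (uocompl tt) -> a = tt.
Proof. by case: a. Qed.

HB.instance Definition _ :=
  isEffectAlgebra.Build unit ucomm uzero uassoc ucompl uunique uorth1.

Let uomega (u : nat -> unit) : increasing u -> exists s, is_supremum u s.
Proof. by exists tt; split=> [n|[] _]; exists tt; split=> //; case: (u _). Qed.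

HB.instance Definition _ := isOmegaComplete.Build unit uomega.

Let umulA x y z : uoplus x (uoplus y z) = uoplus (uoplus x y) z.
Proof. by []. Qed.

Let umul1 x : uoplus x tt = x /\ uoplus tt x = x.
Proof. by case: x. Qed.

Let umulD (x y z : unit) : y ⊥ z ->
  uoplus x y ⊥ uoplus x z /\ uoplus x (y ⊕ z) = uoplus x y ⊕ uoplus x z.
Proof. by []. Qed.

HB.instance Definition _ := isEffectMonoid.Build unit umulA
  (fun x => (umul1 x).1) (fun x => (umul1 x).2) umulD umulD.

End TrivialMonoid.

Lemma unit_final : is_final unit.
Proof.
move=> N; exists (fun=> tt); split; last first.
  by move=> f _; apply/funext => x; case: (f x).
by split=> // u s _ _; split=> [n|[] _]; exists tt; split.
Qed.

Section TwoElementMonoid.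

Let borth (a b : bool) : Prop := ~~ (a && b).

Let bcomm a b : borth a b -> borth b a /\ (a || b) = (b || a).
Proof. by rewrite /borth andbC orbC. Qed.

Let bzero a : borth a false /\ (a || false) = a.
Proof. by case: a. Qed.

Let bassoc a b c : borth a b -> borth (a || b) c ->
  [/\ borth b c, borth a (b || c) & (a || b || c) = (a || (b || c))].
Proof. by case: a b c => [] [] []. Qed.

Let bcompl a : borth a (~~ a) /\ (a || ~~ a) = ~~ false.
Proof. by case: a. Qed.

Let bunique a b : borth a b -> (a || b) = ~~ false -> b = ~~ a.
Proof. by case: a b => [] []. Qed.

Let borth1 a : borth a (~~ false) -> a = false.
Proof. by case: a. Qed.

HB.instance Definition _ :=
  isEffectAlgebra.Build bool bcomm bzero bassoc bcompl bunique borth1.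

Lemma bool_eleE (a b : bool) : a ≼ b <-> a ==> b.
Proof.
split; first by case: a b => [] [] // [[] []].
by case: a b => [] [] // _; [exists false | exists true | exists false].
Qed.

Let bomega (u : nat -> bool) : increasing u -> exists s, is_supremum u s.
Proof.
move=> _; have [[n un]|nu] := pselect (exists n, u n).
  exists true; split=> [m|b ub]; apply/bool_eleE; first exact: implybT.
  by have /bool_eleE := ub n; rewrite un.
exists false; split=> [m|b ub]; apply/bool_eleE => //.
by apply/implyP => um; case: nu; exists m.
Qed.

HB.instance Definition _ := isOmegaComplete.Build bool bomega.

Let bmulDr (x y z : bool) : y ⊥ z ->
  (x && y : bool) ⊥ (x && z) /\ (x && (y ⊕ z)) = (x && y : bool) ⊕ (x && z).
Proof. by case: x y z => [] [] []. Qed.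

Let bmulDl (x y z : bool) : y ⊥ z ->
  (y && x : bool) ⊥ (z && x) /\ ((y ⊕ z) && x) = (y && x : bool) ⊕ (z && x).
Proof. by case: x y z => [] [] []. Qed.

HB.instance Definition _ := isEffectMonoid.Build bool
  andbA andbT andTb bmulDr bmulDl.

End TwoElementMonoid.

Lemma orth0x (E : effectAlgebraType) (a : E) : 0 ⊥ a /\ 0 ⊕ a = a.
Proof.
have [h e] := oplus_zero a; have [k l] := oplus_comm _ _ h.
by rewrite -l.
Qed.

Lemma ele_refl (E : effectAlgebraType) (a : E) : a ≼ a.
Proof. by exists 0; apply: oplus_zero. Qed.

Lemma ele0x (E : effectAlgebraType) (a : E) : 0 ≼ a.
Proof. by exists a; apply: orth0x. Qed.

Lemma elex1 (E : effectAlgebraType) (a : E) : a ≼ 1.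
Proof. by exists (ocompl a); apply: ocompl_sum. Qed.

Lemma emulx0 (M : effectMonoidType) (x : M) : x ⊙ 0 = 0.
Proof.
have [h e] := oplus_zero (0 : M); have [k l] := emulDr x _ _ h.
rewrite e in l; have [p q] := ocompl_sum (x ⊙ 0).
have k' : x ⊙ 0 ⊕ x ⊙ 0 ⊥ ocompl (x ⊙ 0) by rewrite -l.
by have [_ + _] := oplus_assoc _ _ _ k k'; rewrite q => /orth_one.
Qed.

Lemma ea_hom0 (E F : effectAlgebraType) (f : E -> F) : is_ea_hom f -> f 0 = 0.
Proof.
move=> [f1 fD]; apply: orth_one; rewrite -/(eone) -f1.
by apply: (fD _ _ _).1; apply: (orth0x _).1.
Qed.

Lemma bool_initial : is_initial bool.
Proof.
move=> N; pose f (b : bool) : N := if b then 1 else 0.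
exists f; split; last first.
  move=> g [[gh _] _]; apply/funext => -[] /=; last by rewrite (ea_hom0 gh).
  by have [-> _] := gh.
split.
  split; last by case=> [] [] /=; rewrite ?emulx1 ?emul1x ?emulx0.
  split=> // -[] [] // _.
  - by have [h e] := oplus_zero (1 : N); split=> //; apply: esym.
  - by have [h e] := orth0x (1 : N); split=> //; apply: esym.
  - by have [h e] := oplus_zero (0 : N); split=> //; apply: esym.
move=> u [] _ [us sl]; split=> [n|b ub].
- by apply: elex1.
- have [[n un]|nu] := pselect (exists n, u n).
    by have := ub n; rewrite un.
  have /bool_eleE // : true ≼ false.
  by apply: sl => n; apply/bool_eleE/implyP => un; case: nu; exists n.
- by have /bool_eleE := us n; rewrite implybF => /negbTE ->; apply: ele_refl.
- by apply: ele0x.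
Qed.

(* Main.v *)
Require Import Defs.
From HB Require Import structures.
From mathcomp Require Import all_boot all_order all_algebra.
From mathcomp Require Import boolp classical_sets reals.
From mathcomp Require Import lra.

(** The unit interval has the required properties because its only idempotents
    are [0] and [1] (a product decomposition would give another one), and
    because one half has no image in [bool].

    Conversely, let [M] be irreducible, neither initial nor final.  An
    idempotent [e] of an effect monoid is a two-sided unit for the elements
    below it ([idem_fixl], [idem_fixr]), and the monoid is the product of the
    intervals below [e] and below [ocompl e] ([idem_corner_iso]); so the only
    idempotents of [M] are [0] and [1].  Suprema of increasing sequences produce
    idempotents: the infimum of the powers of any element is one
    ([sup_epow_idem]).  Hence the powers of [ocompl c] tend to [0] when
    [c <> 0], the geometric series of the [c ⊙ epow (ocompl c) n] sums to [1],
    and multiplication by [c] reflects the order ([ele_emul_cancelr]).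

    As [M] is neither initial nor final, it has an element other than [0] and
    [1].  Halving a geometric series termwise then yields [h] with [h ⊕ h = 1]
    ([half_exists]).

    The main point is that [M] is totally ordered.  Given [a], consider the
    random walk on the integers that steps up with probability [a] and down
    with probability [ocompl a].  The probability [p] of ever moving one step up
    is a supremum of elements of [M] and solves [p = a ⊕ ocompl a ⊙ p ⊙ p].  In
    the reals, [p] is the minimum of [1] and [a / (1 - a)], so it tells on which
    side of one half [a] lies.  In [M], cancellation of [ocompl p] shows that
    [a ≼ ocompl a] if [p <> 1], and that [ocompl a ≼ a] otherwise
    ([ele_compl_total]).  Applying this to [h ⊙ a ⊕ h ⊙ ocompl b] compares
    [a] with [b] ([ele_total]).

    In a totally ordered [M], every element lies between consecutive multiples
    of [epow h n], for every [n].  Sending [a] to the supremum of the dyadic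
    numbers below it defines an additive map into [[0, 1]]
    ([dyadic_stateP]), and such a map is unique up to scaling ([state_unique]).
    Uniqueness makes it multiplicative, since [a |-> f (a ⊙ b)] is additive as
    well.  It reflects the order because the [epow h n] have infimum [0], and it
    is onto because binary expansions have suprema in [M]. *)

Set Implicit Arguments.
Unset Strict Implicit.
Unset Printing Implicit Defensive.

Import Order.TTheory GRing.Theory Num.Theory.

Local Open Scope effect_scope.

(** * Partial addition as a commutative monoid *)

Section PartialSum.
Variable E : effectAlgebraType.
Implicit Types (a b c d : E) (x y z : option E).

(** Adding an absorbing value [None] for undefined sums makes [⊕] a total
    commutative monoid operation.  A chain of partial sums, together with all
    the definedness conditions that it presupposes, is then one equation
    [_ = Some _], which may be reassociated freely. *)
Definition osum x y : option E :=
  if x is Some a then if y is Some b then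
    if pselect (a ⊥ b) then Some (a ⊕ b) else None
  else None else None.

Local Notation "x ⊞ y" := (osum x y) (at level 50, left associativity).

Lemma osumE a b c : Some a ⊞ Some b = Some c <-> a ⊥ b /\ a ⊕ b = c.
Proof.
rewrite /osum; case: pselect => ab; last by split=> // -[].
by split=> [[]|[_ ->]].
Qed.

Lemma osum_orth a b : a ⊥ b -> Some a ⊞ Some b = Some (a ⊕ b).
Proof. by move=> ab; apply/osumE. Qed.

Lemma osum_defined x y c :
  x ⊞ y = Some c -> exists a b, x = Some a /\ y = Some b.
Proof. by case: x y => [a|] [b|] // _; exists a, b. Qed.

Lemma osumC : commutative osum.
Proof.
move=> [a|] [b|] //; rewrite /osum.
case: pselect => ab.
  by have [ba ->] := oplus_comm _ _ ab; case: pselect.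
by case: pselect => // ba; case: ab; case: (oplus_comm _ _ ba).
Qed.

Lemma osum0x : left_id (Some 0) osum.
Proof. by move=> [a|] //; apply/osumE/orth0x. Qed.

Let osumA_defined x y z c : x ⊞ y ⊞ z = Some c -> x ⊞ (y ⊞ z) = Some c.
Proof.
case: z => [d|]; last by case: x y => [a|] [b|] //=; case: pselect.
case: x y => [a|] [b|] // /[dup] /osum_defined[w [_ [ew _]]].
rewrite ew => /osumE[wd <-]; move: ew wd => /osumE[ab <-] abd.
have [bd a_bd ->] := oplus_assoc _ _ _ ab abd.
by rewrite (osum_orth bd) (osum_orth a_bd).
Qed.

Lemma osumA : associative osum.
Proof.
move=> x y z; case e: (x ⊞ y ⊞ z) => [c|]; first exact: osumA_defined.
case f: (x ⊞ (y ⊞ z)) => [c|] //.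
move: f; rewrite osumC [y ⊞ z]osumC => /osumA_defined.
by rewrite osumC [y ⊞ x]osumC e.
Qed.

Lemma osumCA : left_commutative osum.
Proof. by move=> x y z; rewrite !osumA (osumC x). Qed.

Lemma osumAC : right_commutative osum.
Proof. by move=> x y z; rewrite -!osumA (osumC y). Qed.

Lemma osumACA : interchange osum osum.
Proof. by move=> x y z t; rewrite -!osumA (osumCA y). Qed.

Lemma osumx0 : right_id (Some 0) osum.
Proof. by move=> x; rewrite osumC osum0x. Qed.

Lemma osum_compl a : Some a ⊞ Some (ocompl a) = Some 1.
Proof. by apply/osumE/ocompl_sum. Qed.

Lemma osum1_compl a x : Some a ⊞ x = Some 1 -> x = Some (ocompl a).
Proof.
case: x => [b|] // /osumE[ab e]; congr Some.
exact: ocompl_unique.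
Qed.

Lemma ocomplK a : ocompl (ocompl a) = a.
Proof.
have := osum_compl a; rewrite osumC => /osum1_compl.
by case.
Qed.

Lemma ocompl1 : ocompl (1 : E) = 0.
Proof. by have := osumx0 (Some (1 : E)) => /osum1_compl[]. Qed.

Lemma osum_cancel a x y c :
  Some a ⊞ x = Some c -> Some a ⊞ y = Some c -> x = y.
Proof.
move=> ex ey; have e z : Some a ⊞ z = Some c ->
    z ⊞ (Some a ⊞ Some (ocompl c)) = Some 1.
  by move=> h; rewrite osumA (osumC z) h osum_compl.
have [_ [d [_ ed]]] := osum_defined (e x ex).
have {}e z : Some a ⊞ z = Some c -> z = Some (ocompl d).
  by move=> /e; rewrite ed osumC => /osum1_compl.
by rewrite (e x) // (e y).
Qed.

Lemma osum_eq0 a x : Some a ⊞ x = Some 0 -> a = 0.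
Proof.
move=> e; have : Some a ⊞ x ⊞ Some 1 = Some 1 by rewrite e osum0x.
rewrite osumAC => /osum_defined[b [_ [/osumE[a1 _] _]]].
exact: orth_one.
Qed.

Lemma osum_idem a x : Some a ⊞ x = Some a -> x = Some 0.
Proof. by move=> /osum_cancel; apply; apply: osumx0. Qed.

(** * The order of an effect algebra *)

Lemma eleP a b : a ≼ b <-> exists x, Some a ⊞ x = Some b.
Proof.
split=> [[c h]|[[c|] // /osumE h]]; last by exists c.
by exists (Some c); apply/osumE.
Qed.

Lemma osum_elel x a c : x ⊞ Some a = Some c -> a ≼ c.
Proof. by move=> h; apply/eleP; exists x; rewrite osumC. Qed.

Lemma osum_eler x a c : Some a ⊞ x = Some c -> a ≼ c.
Proof. by move=> h; apply/eleP; exists x. Qed.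

Lemma ele_trans b a c : a ≼ b -> b ≼ c -> a ≼ c.
Proof.
move=> /eleP[x ex] /eleP[y ey]; apply/eleP; exists (x ⊞ y).
by rewrite osumA ex.
Qed.

Lemma ele_anti a b : a ≼ b -> b ≼ a -> a = b.
Proof.
move=> /eleP[x ex] /eleP[y]; rewrite -ex -osumA => /osum_idem e.
have [c [_ [xc _]]] := osum_defined e.
move: e ex; rewrite xc => /osum_eq0->.
by rewrite osumx0; case.
Qed.

Lemma elex0 a : a ≼ 0 -> a = 0.
Proof. by move=> a0; apply: ele_anti => //; apply: ele0x. Qed.

Lemma ele_osum a b x c : a ≼ b -> Some b ⊞ x = Some c ->
  exists2 d, Some a ⊞ x = Some d & d ≼ c.
Proof.
move=> /eleP[y <-]; rewrite osumAC => /[dup] /osum_defined[d [_ [ed _]]].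
by rewrite ed => h; exists d => //; apply/eleP; exists y.
Qed.

Lemma ele_osum2 a b c d w : a ≼ b -> c ≼ d -> Some b ⊞ Some d = Some w ->
  exists2 v, Some a ⊞ Some c = Some v & v ≼ w.
Proof.
move=> ab cd /(ele_osum ab)[v]; rewrite osumC => /(ele_osum cd)[u].
by rewrite osumC => e uv vw; exists u => //; apply: ele_trans vw.
Qed.

Lemma ele_osum_cancel a b c v w :
  Some a ⊞ Some b = Some v -> Some a ⊞ Some c = Some w -> v ≼ w -> b ≼ c.
Proof.
move=> ev ew /eleP[x]; rewrite -ev -osumA => e; apply/eleP; exists x.
exact: osum_cancel e ew.
Qed.

Lemma ele_compl a b : a ≼ b -> ocompl b ≼ ocompl a.
Proof.
move=> /eleP[x e]; apply: (@osum_elel x); apply: (@osum1_compl a).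
by rewrite osumA e osum_compl.
Qed.

Lemma ele_complP a b : a ≼ ocompl b <-> exists c, Some a ⊞ Some b = Some c.
Proof.
split=> [h|[c e]].
  have := osum_compl b; rewrite osumC => /(ele_osum h)[c e _].
  by exists c.
apply: (@osum_eler (Some (ocompl c))); apply: (@osum1_compl b).
by rewrite osumA (osumC (Some b)) e osum_compl.
Qed.

End PartialSum.

Arguments osum : simpl never.

Local Notation "x ⊞ y" := (osum x y) (at level 50, left associativity)
  : effect_scope.

(** * Suprema of increasing sequences *)

Section Suprema.
Variable E : effectAlgebraType.
Implicit Types (a b c : E) (u v : nat -> E).

Lemma increasing_le u m n : increasing u -> (m <= n)%N -> u m ≼ u n.
Proof.
move=> uI /subnK<-; elim: (n - m)%N => [|k]; first exact: ele_refl.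
by move=> /ele_trans; apply; apply: uI.
Qed.

(** The differences of [a] and the [u n] have infimum zero.  That [b] is below
    all of them is said without subtraction. *)
Lemma supremum_gap u a b : is_supremum u a ->
  (forall n, exists c, Some (u n) ⊞ Some b = Some c /\ c ≼ a) -> b = 0.
Proof.
move=> [ua al] ub; have [c [/[dup] ec /osum_elel bc ca]] := ub 0%N.
have /eleP[x e] := ele_trans bc ca.
have [_ [d [_ xd]]] := osum_defined e; rewrite xd in e.
suff /eleP[y ey] : a ≼ d.
  by move: e; rewrite -ey osumCA => /osum_idem/osum_eq0.
apply: al => n; have [c' [e']] := ub n.
by rewrite osumC in e'; apply: ele_osum_cancel e' e.
Qed.

End Suprema.

(** * Multiplication and idempotents *)

Section EffectMonoid.
Variable M : effectMonoidType.
Implicit Types (a b c e x y z : M).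

Lemma emul_sumr x a b c : Some a ⊞ Some b = Some c ->
  Some (x ⊙ a) ⊞ Some (x ⊙ b) = Some (x ⊙ c).
Proof. by move=> /osumE[ab <-]; apply/osumE; have [h ->] := emulDr x _ _ ab. Qed.

Lemma emul_suml x a b c : Some a ⊞ Some b = Some c ->
  Some (a ⊙ x) ⊞ Some (b ⊙ x) = Some (c ⊙ x).
Proof. by move=> /osumE[ab <-]; apply/osumE; have [h ->] := emulDl x _ _ ab. Qed.

Lemma emul0x x : 0 ⊙ x = 0.
Proof.
have := emul_suml x (osum0x (Some (0 : M))) => /osum_idem.
by case.
Qed.

Lemma ele_emulr x a b : a ≼ b -> x ⊙ a ≼ x ⊙ b.
Proof.
by move=> [c /osumE /(emul_sumr x) h]; apply: osum_eler h.
Qed.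

Lemma ele_emull x a b : a ≼ b -> a ⊙ x ≼ b ⊙ x.
Proof.
by move=> [c /osumE /(emul_suml x) h]; apply: osum_eler h.
Qed.

Lemma emul_ler a x : a ⊙ x ≼ a.
Proof. by have := ele_emulr a (elex1 x); rewrite emulx1. Qed.

Lemma emul_lel a x : a ⊙ x ≼ x.
Proof. by have := ele_emull x (elex1 a); rewrite emul1x. Qed.

Lemma emul_splitl a x : Some (a ⊙ x) ⊞ Some (ocompl a ⊙ x) = Some x.
Proof. by rewrite (emul_suml x (osum_compl a)) emul1x. Qed.

Lemma emul_splitr a x : Some (x ⊙ a) ⊞ Some (x ⊙ ocompl a) = Some x.
Proof. by rewrite (emul_sumr x (osum_compl a)) emulx1. Qed.

Lemma emul_complC a : a ⊙ ocompl a = ocompl a ⊙ a.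
Proof.
by have [] := osum_cancel (emul_splitr a a) (emul_splitl a a).
Qed.

Lemma idem_emul_compl e : e ⊙ e = e <-> e ⊙ ocompl e = 0.
Proof.
have := emul_splitr e e; split=> h; move: H; rewrite h.
  by move=> /osum_idem[].
by rewrite osumx0 => -[].
Qed.

Lemma idem_compl e : e ⊙ e = e -> ocompl e ⊙ ocompl e = ocompl e.
Proof. by rewrite !idem_emul_compl ocomplK -emul_complC. Qed.

Section Idempotent.
Variable e : M.
Hypothesis ee : e ⊙ e = e.

Lemma idem_fixl x : x ≼ e -> e ⊙ x = x.
Proof.
have e0 := (idem_emul_compl e).1 ee; rewrite emul_complC in e0.
move=> /(ele_emulr (ocompl e)); rewrite e0 => /elex0 h.
by have := emul_splitl e x; rewrite h osumx0 => -[].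
Qed.

Lemma idem_fixr x : x ≼ e -> x ⊙ e = x.
Proof.
have e0 := (idem_emul_compl e).1 ee.
move=> /(ele_emull (ocompl e)); rewrite e0 => /elex0 h.
by have := emul_splitr e x; rewrite h osumx0 => -[].
Qed.

End Idempotent.

End EffectMonoid.

(** Bijective homomorphisms of effect algebras need not reflect [⊥], hence the
    extra hypothesis. *)
Lemma bij_emonoid_iso (M N : effectMonoidType) (f : M -> N) (g : N -> M) :
  is_emonoid_hom f -> (forall a b, f a ⊥ f b -> a ⊥ b) ->
  cancel f g -> cancel g f -> emonoid_iso M N.
Proof.
move=> /[dup] hf [[f1 fD] fM] fR fK gK; exists f, g; split=> //.
split; last by move=> x y; rewrite -{1}(gK x) -{1}(gK y) -fM fK.
split=> [|a b ab]; first by rewrite -f1 fK.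
have gab : g a ⊥ g b by apply: fR; rewrite !gK.
by split=> //; rewrite -{1}(gK a) -{1}(gK b) -(fD _ _ gab).2 fK.
Qed.

(** * The corner of an idempotent *)

Record corner (M : omegaEffectMonoidType) (e : M) (ee : e ⊙ e = e) := Corner {
  corner_val : M ;
  corner_fix : e ⊙ corner_val = corner_val
}.

Section Corner.
Variables (M : omegaEffectMonoidType) (e : M) (ee : e ⊙ e = e).
Local Notation C := (corner ee).
Local Notation val := (@corner_val M e ee).
Implicit Types x y z : C.

Lemma corner_inj : injective val.
Proof.
move=> [a pa] [b pb] /= ab; move: pa pb; rewrite -ab => pa pb.
by congr Corner; apply: Prop_irrelevance.
Qed.

Lemma emul_corner a : e ⊙ (e ⊙ a) = e ⊙ a.
Proof. by rewrite emulA ee. Qed.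

Definition to_corner a : C := Corner ee (emul_corner a).

Lemma corner_le x : val x ≼ e.
Proof. by rewrite -corner_fix; apply: emul_ler. Qed.

Let czero : C := Corner ee (emulx0 e).
Let corth x y := val x ⊥ val y.
(* The projection fixes the defined sums and sends the junk values of the
   undefined ones into the corner. *)
Let coplus x y := to_corner (val x ⊕ val y).
Let cocompl x := to_corner (ocompl (val x)).

Let coplusE x y : corth x y ->
  Some (val x) ⊞ Some (val y) = Some (val (coplus x y)).
Proof.
by move=> /osum_orth /(emul_sumr e); rewrite !corner_fix.
Qed.

Let coplusP x y z : Some (val x) ⊞ Some (val y) = Some (val z) ->
  corth x y /\ coplus x y = z.
Proof.
move=> h; have /osumE[xy _] := h; split=> //.
apply: corner_inj.
by move: h; rewrite coplusE // => -[].
Qed.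

Let cone : val (cocompl czero) = e.
Proof. exact: emulx1. Qed.

Let coplus_comm x y : corth x y -> corth y x /\ coplus x y = coplus y x.
Proof.
move=> /coplusE; rewrite osumC => /coplusP[yx ->]; split=> //.
Qed.

Let coplus_zero x : corth x czero /\ coplus x czero = x.
Proof. by apply: coplusP; rewrite osumx0. Qed.

Let coplus_assoc x y z : corth x y -> corth (coplus x y) z ->
  [/\ corth y z, corth x (coplus y z) &
      coplus (coplus x y) z = coplus x (coplus y z)].
Proof.
move=> /coplusE xy /coplusE; rewrite -xy -osumA => h.
have [_ [w [_ /[dup] yz ew]]] := osum_defined h.
have [/coplusE yz' _] := (osumE _ _ _).1 ew.
rewrite yz' in h; have [xyz e3] := coplusP h.
by split=> //; case: ((osumE _ _ _).1 ew).
Qed.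

Let cocompl_sum x : corth x (cocompl x) /\
  coplus x (cocompl x) = cocompl czero.
Proof.
apply: coplusP; rewrite cone -{1}corner_fix.
exact: emul_splitr (val x) e.
Qed.

Let cocompl_unique x y : corth x y -> coplus x y = cocompl czero ->
  y = cocompl x.
Proof.
move=> /coplusE + h; rewrite h => exy; apply: corner_inj.
have [/coplusE + h'] := cocompl_sum x; rewrite h' => exy'.
by have [] := osum_cancel exy exy'.
Qed.

Let corth_one x : corth x (cocompl czero) -> x = czero.
Proof.
move=> /coplusE; rewrite cone osumC => h; apply: corner_inj.
have /eleP[y] := corner_le (coplus x (cocompl czero)).
by rewrite -h -osumA => /osum_idem/osum_eq0.
Qed.

HB.instance Definition _ := isEffectAlgebra.Build C
  coplus_comm coplus_zero coplus_assoc cocompl_sum cocompl_unique corth_one.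

Lemma corner_osum x y z :
  Some x ⊞ Some y = Some z <-> Some (val x) ⊞ Some (val y) = Some (val z).
Proof.
split=> [/osumE[xy <-]|h]; first exact: coplusE.
by apply/osumE/coplusP.
Qed.

Lemma corner_ele x y : x ≼ y <-> val x ≼ val y.
Proof.
split=> [[z /osumE/corner_osum h]|[a /osumE h]]; first exact: osum_eler h.
have af : e ⊙ a = a.
  by apply: idem_fixl => //; apply: ele_trans (corner_le y); apply: osum_elel h.
by apply/eleP; exists (Some (Corner ee af)); apply/corner_osum.
Qed.

Let comega (u : nat -> C) : increasing u -> exists s, is_supremum u s.
Proof.
move=> uI; have [|s [us sl]] := @omega_complete M (fun n => val (u n)).
  by move=> n; apply/corner_ele.
have sf : e ⊙ s = s by apply: idem_fixl => //; apply: sl => n; apply: corner_le.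
exists (Corner ee sf); split=> [n|b ub]; apply/corner_ele => //=.
by apply: sl => n; apply/corner_ele.
Qed.

HB.instance Definition _ := isOmegaComplete.Build C comega.

Let cmul_fix x y : e ⊙ (val x ⊙ val y) = val x ⊙ val y.
Proof. by rewrite emulA corner_fix. Qed.

Let cmul x y : C := Corner ee (cmul_fix x y).

Let cmulA x y z : cmul x (cmul y z) = cmul (cmul x y) z.
Proof. by apply: corner_inj; apply: emulA. Qed.

Let cmulx1 x : cmul x 1 = x.
Proof.
by apply: corner_inj; rewrite /= emulx1 idem_fixr //; apply: corner_le.
Qed.

Let cmul1x x : cmul 1 x = x.
Proof. by apply: corner_inj; rewrite /= emulx1 corner_fix. Qed.

Let cmulDr x y z : y ⊥ z ->
  cmul x y ⊥ cmul x z /\ cmul x (y ⊕ z) = cmul x y ⊕ cmul x z.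
Proof.
move=> /osum_orth/corner_osum/(emul_sumr (val x)) h.
by have /osumE[? <-] := (corner_osum (cmul x y) (cmul x z) (cmul x (y ⊕ z))).2 h.
Qed.

Let cmulDl x y z : y ⊥ z ->
  cmul y x ⊥ cmul z x /\ cmul (y ⊕ z) x = cmul y x ⊕ cmul z x.
Proof.
move=> /osum_orth/corner_osum/(emul_suml (val x)) h.
by have /osumE[? <-] := (corner_osum (cmul y x) (cmul z x) (cmul (y ⊕ z) x)).2 h.
Qed.

HB.instance Definition _ := isEffectMonoid.Build C
  cmulA cmulx1 cmul1x cmulDr cmulDl.

Lemma corner_one : val 1 = e. Proof. exact: emulx1. Qed.

Lemma corner_mul x y : val (x ⊙ y) = val x ⊙ val y. Proof. by []. Qed.

Lemma to_corner_osum a b c : Some a ⊞ Some b = Some c ->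
  Some (to_corner a) ⊞ Some (to_corner b) = Some (to_corner c).
Proof. by move=> /(emul_sumr e) h; apply/corner_osum. Qed.

Lemma to_corner_hom : is_emonoid_hom to_corner.
Proof.
split; last first.
  move=> a b; apply: corner_inj; rewrite corner_mul /=.
  by rewrite [RHS]emulA (idem_fixr ee (emul_ler _ _)) emulA.
by split=> [|a b /osum_orth/to_corner_osum/osumE[]].
Qed.

End Corner.

(** Products of an element below [e] with one below [ocompl e] vanish, because
    [e ⊙ ocompl e = 0].  So multiplication is componentwise after splitting [a]
    as [e ⊙ a ⊕ ocompl e ⊙ a]. *)
Lemma idem_corner_iso (M : omegaEffectMonoidType) (e : M) (ee : e ⊙ e = e) :
  emonoid_iso M (corner ee * corner (idem_compl ee))%type.
Proof.
set ee' := idem_compl ee.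
pose f a := (to_corner ee a, to_corner ee' a).
pose g (p : corner ee * corner ee') := corner_val p.1 ⊕ corner_val p.2.
have gP p : Some (corner_val p.1) ⊞ Some (corner_val p.2) = Some (g p).
  case: p => y z; have := osum_compl e.
  move=> /(ele_osum2 (corner_le y) (corner_le z))[w ew _].
  by apply: osum_orth; case/osumE: ew.
have [[f1 fD] fM] := to_corner_hom ee; have [[f1' fD'] fM'] := to_corner_hom ee'.
apply: (@bij_emonoid_iso _ _ f g).
- split; last by move=> x y; rewrite /f fM fM'.
  split=> [|a b ab]; first by rewrite /f f1 f1'.
  have [h1 e1] := fD _ _ ab; have [h2 e2] := fD' _ _ ab.
  by split; [split | rewrite /f e1 e2].
- move=> a b [/osum_orth/corner_osum h /osum_orth/corner_osum h'].
  have := gP (to_corner ee a ⊕ to_corner ee b, to_corner ee' a ⊕ to_corner ee' b).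
  by rewrite -h -h' osumACA /= !emul_splitl => /osumE[].
- by move=> a; have := gP (f a); rewrite /= emul_splitl => -[].
- move=> [y z]; have h := gP (y, z); rewrite /= in h.
  have fixe := corner_fix y; have fixe' := corner_fix z.
  congr (_, _); apply: corner_inj => /=.
  + have := emul_sumr e h; rewrite fixe -[in e ⊙ corner_val z]fixe' emulA.
    by rewrite (idem_emul_compl e).1 // emul0x osumx0 => -[].
  + have := emul_sumr (ocompl e) h; rewrite fixe' -[in _ ⊙ corner_val y]fixe.
    by rewrite emulA -emul_complC (idem_emul_compl e).1 // emul0x osum0x => -[].
Qed.

Lemma final_trivial (M : omegaEffectMonoidType) : is_final M -> (1 : M) = 0.
Proof.
move=> /(_ unit)[f [[[fh _] _] _]]; have f0 := ea_hom0 fh; have [f1 _] := fh.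
by rewrite -f0 -f1.
Qed.

Lemma trivial_final (M : omegaEffectMonoidType) : (1 : M) = 0 -> is_final M.
Proof.
move=> M10; have M0 (x : M) : x = 0 by rewrite -(emulx1 x) M10 emulx0.
move=> N; exists (fun=> 0); split; last by move=> f _; apply/funext.
split; last first.
  move=> u s _ _; split=> [n|b _]; [exact: ele_refl|exact: ele0x].
split; last by move=> x y; rewrite [RHS]M0.
split=> [|a b _]; first by rewrite [RHS]M0.
by have [? ->] := oplus_zero (0 : M).
Qed.

(** The two corners of [idem_corner_iso] have units [e] and [ocompl e], and the
    final corner has unit [0]. *)
Lemma irreducible_idem (M : omegaEffectMonoidType) (e : M) :
  is_irreducible M -> e ⊙ e = e -> e = 0 \/ e = 1.
Proof.
move=> irr ee; have [|] := irr _ _ (idem_corner_iso ee).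
  by move=> /final_trivial/(congr1 (@corner_val _ _ _)); rewrite corner_one; left.
move=> /final_trivial/(congr1 (@corner_val _ _ _)); rewrite corner_one /= => h.
by right; have := osum_compl e; rewrite h osumx0 => -[].
Qed.

(** * Suprema and multiplication *)

Section OmegaMonoid.
Variable M : omegaEffectMonoidType.
Implicit Types (a b c x y z s : M) (u : nat -> M).

(** Multiplication preserves suprema of increasing sequences.  If [s] is the
    supremum of [u] and [u n ⊕ r n = s], then the gap between [x ⊙ s ⊙ z] and
    the supremum of the [x ⊙ u n ⊙ z] is below every [x ⊙ r n ⊙ z], hence below
    every [r n], hence zero. *)
Lemma sup_emul u s x y z : increasing u -> is_supremum u s ->
  (forall n, x ⊙ u n ⊙ z ≼ y) -> x ⊙ s ⊙ z ≼ y.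
Proof.
move=> uI us uy; have [us1 _] := us.
have [|t [vt tl]] := @omega_complete M (fun n => x ⊙ u n ⊙ z).
  by move=> n; apply/ele_emull/ele_emulr.
have ty : t ≼ y by apply: tl.
have /eleP[r er] : t ≼ x ⊙ s ⊙ z.
  by apply: tl => n; apply/ele_emull/ele_emulr.
have [_ [r' [_ rr']]] := osum_defined er; rewrite {r}rr' in er.
suff r0 : r' = 0 by move: er; rewrite r0 osumx0 => -[<-].
apply: (supremum_gap us) => n.
have [q eq] := us1 n; have {}eq := (osumE _ _ _).2 eq.
suff rq : r' ≼ q.
  by have [c] := ele_osum rq (etrans (osumC _ _) eq); rewrite osumC; exists c.
apply: (@ele_trans _ (x ⊙ q ⊙ z)); last first.
  by apply: ele_trans (emul_ler _ _) _; apply: emul_lel.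
have e1 := emul_suml z (emul_sumr x eq).
have /eleP[t' et] := vt n.
apply: (@osum_elel _ t'); apply: osum_cancel e1.
by rewrite osumA et.
Qed.

Definition epow c n : M := iter n (emul c) 1.

Lemma epowD c m n : epow c (m + n) = epow c m ⊙ epow c n.
Proof.
elim: m => [|m IH]; first by rewrite add0n emul1x.
by rewrite addSn /epow !iterS -/(epow c _) IH emulA.
Qed.

Lemma increasing_epow c : increasing (fun n => ocompl (epow c n)).
Proof. by move=> n; apply/ele_compl/emul_lel. Qed.

Lemma epow_complD c m n :
  Some (ocompl (epow c m)) ⊞ Some (epow c m ⊙ ocompl (epow c n)) =
  Some (ocompl (epow c (m + n))).
Proof.
apply: osum1_compl; rewrite osumCA epowD emul_splitr osumC.
exact: osum_compl.
Qed.

Lemma epow_complS c n :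
  Some (ocompl (epow (ocompl c) n)) ⊞ Some (c ⊙ epow (ocompl c) n) =
  Some (ocompl (epow (ocompl c) n.+1)).
Proof.
apply: osum1_compl; rewrite osumCA (osumC (Some (epow _ _.+1))) emul_splitl osumC.
exact: osum_compl.
Qed.

(** The infimum [e = ocompl s] of the powers of [c] is idempotent: it is below
    every power [epow c m], so [e ⊙ ocompl (epow c n)] is below the difference
    of [epow c m] and [epow c (m + n)], which is as small as one likes. *)
Lemma sup_epow_idem c s :
  is_supremum (fun n => ocompl (epow c n)) s -> s ⊙ s = s.
Proof.
move=> sP; apply/idem_emul_compl; rewrite emul_complC -[LHS]emulx1.
apply: elex0; apply: (sup_emul (@increasing_epow c) sP) => n.
rewrite emulx1.
suff -> : ocompl s ⊙ ocompl (epow c n) = 0 by apply: ele0x.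
have [us _] := sP; apply: (supremum_gap sP) => m.
have le : ocompl s ⊙ ocompl (epow c n) ≼ epow c m ⊙ ocompl (epow c n).
  by apply: ele_emull; rewrite -[epow c m]ocomplK; apply: ele_compl.
have := epow_complD c m n; rewrite osumC => /(ele_osum le)[w].
rewrite osumC => ew wle; exists w; split=> //.
exact: (ele_trans wle (us _)).
Qed.

End OmegaMonoid.

(** * Monoids with only trivial idempotents *)

Section TrivialIdempotents.
Variable M : omegaEffectMonoidType.
Hypothesis idem01 : forall e : M, e ⊙ e = e -> e = 0 \/ e = 1.
Implicit Types (a b c x y z s : M) (u : nat -> M).

Lemma sup_epow1 c : c <> 0 ->
  is_supremum (fun n => ocompl (epow (ocompl c) n)) 1.
Proof.
move=> c0; have [s sP] := omega_complete _ (@increasing_epow M (ocompl c)).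
suff s1 : s = 1 by rewrite -s1.
have [s0|//] := idem01 (sup_epow_idem sP).
case: c0; apply: elex0; rewrite -s0.
by have [/(_ 1%N)] := sP; rewrite /= emulx1 ocomplK.
Qed.

(** Multiplication by [c <> 0] reflects the order, because [1] is the sum of
    the geometric series with terms [c ⊙ epow (ocompl c) n]. *)
Lemma ele_emul_cancelr c x y : c <> 0 -> x ⊙ c ≼ y ⊙ c -> x ≼ y.
Proof.
move=> c0 xy; set s := fun n => ocompl (epow (ocompl c) n).
have {}xy n : x ⊙ s n ≼ y ⊙ s n.
  elim: n => [|n IH]; first by rewrite /s /= ocompl1 !emulx0; apply: ele_refl.
  have h z := emul_sumr z (epow_complS c n).
  have le := ele_emull (epow (ocompl c) n) xy; rewrite -!emulA in le.
  by have [v] := ele_osum2 IH le (h y); rewrite h => -[<-].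
rewrite -(emulx1 x) -(emulx1 (x ⊙ 1)).
apply: (sup_emul (@increasing_epow M (ocompl c)) (sup_epow1 c0)) => n.
by rewrite emulx1; apply: ele_trans (xy n) _; apply: emul_ler.
Qed.

(** The element [c = a ⊙ ocompl a] is summable with itself, since it lies below
    both [a] and [ocompl a].  With [b = c ⊕ c], the geometric series with terms
    [b ⊙ epow (ocompl b) n] sums to [1], and its termwise half is the series
    with terms [c ⊙ epow (ocompl b) n]. *)
Lemma half_exists a : a <> 0 -> a <> 1 ->
  exists h : M, Some h ⊞ Some h = Some 1.
Proof.
move=> a0 a1; set c := a ⊙ ocompl a.
have c0 : c <> 0 by move=> /idem_emul_compl/idem01[].
have [b eb] : exists b, Some c ⊞ Some c = Some b.
  apply/ele_complP; apply: ele_trans (emul_ler _ _) _.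
  by rewrite -[X in X ≼ _]ocomplK; apply/ele_compl/emul_lel.
have b0 : b <> 0 by move=> b0; move: eb; rewrite b0 => /osum_eq0.
pose e n := epow (ocompl b) n.
pose t := fix t n := if n is n'.+1 then t n' ⊕ c ⊙ e n' else 0.
have tt n : Some (t n) ⊞ Some (t n) = Some (ocompl (e n)) /\
    Some (t n) ⊞ Some (c ⊙ e n) = Some (t n.+1).
  have step k : Some (t k) ⊞ Some (t k) = Some (ocompl (e k)) ->
      Some (t k) ⊞ Some (c ⊙ e k) = Some (t k.+1) /\
      Some (t k.+1) ⊞ Some (t k.+1) = Some (ocompl (e k.+1)).
    move=> tk; have := epow_complS b k.
    rewrite -/(e k) -tk -(emul_suml (e k) eb) osumACA => h.
    have [w [_ [ew _]]] := osum_defined h.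
    have -> : t k.+1 = w by case/osumE: ew.
    by rewrite -h ew.
  suff tk : Some (t n) ⊞ Some (t n) = Some (ocompl (e n)).
    by split=> //; have [] := step _ tk.
  elim: n => [|n /step[]//].
  by rewrite osumx0 /e /= ocompl1.
have tI : increasing t by move=> n; have [_] := tt n; apply: osum_eler.
have [h hP] := omega_complete t tI; have [th hl] := hP.
have [w ew] : exists w, Some h ⊞ Some h = Some w.
  apply/ele_complP/hl => n; rewrite -[t n]ocomplK; apply/ele_compl/hl => m.
  apply: ele_trans (increasing_le tI (leq_maxl m n)) _.
  apply: (ele_trans (b := ocompl (t (maxn m n)))).
    by apply/ele_complP; exists (ocompl (e (maxn m n))); have [] := tt (maxn m n).
  by apply/ele_compl/increasing_le/leq_maxr.
exists h; rewrite ew; congr Some; apply: ele_anti; first exact: elex1.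
have [_] := sup_epow1 b0; apply=> n.
have [v ev vw] := ele_osum2 (th n) (th n) ew.
by move: ev; have [-> _] := tt n => -[->].
Qed.

(** * Comparison of an element with its complement *)

Section Comparison.
Variable a : M.

(** For the random walk on the integers that steps up with probability [a] and
    down with probability [ocompl a], the probability of ever reaching [1] from
    [0] is the least fixed point of [walk]. *)
Definition walk x : M := a ⊕ ocompl a ⊙ (x ⊙ x).

Lemma walk_osum x : Some a ⊞ Some (ocompl a ⊙ (x ⊙ x)) = Some (walk x).
Proof.
have le := emul_ler (ocompl a) (x ⊙ x).
have := osum_compl a; rewrite osumC => /(ele_osum le)[w].
by rewrite osumC => /osumE[h _] _; apply: osum_orth.
Qed.

Lemma walk_mono x y : x ≼ y -> walk x ≼ walk y.
Proof.
move=> xy; have := walk_osum y; rewrite osumC.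
have le : ocompl a ⊙ (x ⊙ x) ≼ ocompl a ⊙ (y ⊙ y).
  by apply: ele_emulr; apply: ele_trans (ele_emull _ xy) (ele_emulr _ xy).
by move=> /(ele_osum le)[w]; rewrite osumC walk_osum => -[->].
Qed.

(** With [y] for the complement of [x], the complement of [x ⊙ x] is
    [y ⊕ x ⊙ y]; this takes the place of the factorization of [1 - x ^ 2]. *)
Lemma walk_compl x :
  Some (ocompl a ⊙ ocompl x) ⊞ Some (ocompl a ⊙ x ⊙ ocompl x) =
  Some (ocompl (walk x)).
Proof.
apply: osum1_compl; rewrite -walk_osum -emulA -osumA.
rewrite [X in Some a ⊞ X]osumCA (emul_sumr (ocompl a) (emul_splitr x x)).
by rewrite [X in Some a ⊞ X]osumC emul_splitr osum_compl.
Qed.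

(** By [walk_compl], [x ≼ walk x] says that
    [ocompl a ⊙ ocompl x ⊕ ocompl a ⊙ x ⊙ ocompl x] is at most
    [ocompl x = ocompl a ⊙ ocompl x ⊕ a ⊙ ocompl x].  Dropping the common
    summand leaves a comparison of multiples of [ocompl x], a nonzero factor. *)
Lemma walk_ge x : x <> 1 -> x ≼ walk x -> ocompl a ⊙ x ≼ a.
Proof.
move=> x1 /ele_compl le; apply: (@ele_emul_cancelr (ocompl x)).
  by move=> h; apply: x1; have := osum_compl x; rewrite h osumx0 => -[].
apply: ele_osum_cancel (walk_compl x) _ le.
by rewrite osumC emul_splitl.
Qed.

Lemma walk_le x : x <> 1 -> walk x ≼ x -> a ≼ ocompl a ⊙ x.
Proof.
move=> x1 /ele_compl le; apply: (@ele_emul_cancelr (ocompl x)).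
  by move=> h; apply: x1; have := osum_compl x; rewrite h osumx0 => -[].
apply: ele_osum_cancel _ (walk_compl x) le.
by rewrite osumC emul_splitl.
Qed.

(** Let [p] be the probability that the walk reaches [1].  If [p <> 1] then
    cancelling [ocompl p] in the fixed point equation gives
    [a = ocompl a ⊙ p].  If [p = 1] and [ocompl a <> 0], no approximation
    [iter n walk 0] equals [1], so all satisfy [ocompl a ⊙ iter n walk 0 ≼ a],
    and their supremum is [1]. *)
Lemma ele_compl_total : a ≼ ocompl a \/ ocompl a ≼ a.
Proof.
pose p n := iter n walk 0.
have pI : increasing p.
  by elim=> [|n IH]; [exact: ele0x | exact: walk_mono].
have [q qP] := omega_complete p pI; have [pq ql] := qP.
have [q1|q1] := pselect (q = 1); last first.
  left; apply: ele_trans (emul_ler _ _); apply: walk_le q1 _.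
  have /eleP[y] : a ≼ q.
    by apply: ele_trans (pq 1%N); apply: osum_eler (walk_osum 0).
  move=> /[dup] /osum_defined[_ [y' [_ ->]]] ey.
  suff le : ocompl a ⊙ (q ⊙ q) ≼ y'.
    move: ey; rewrite osumC => /(ele_osum le)[w].
    by rewrite osumC walk_osum => -[->].
  rewrite emulA -[X in X ≼ _]emulx1.
  apply: (sup_emul pI qP) => m; rewrite emulx1.
  apply: (sup_emul pI qP) => n; rewrite -emulA.
  set k := maxn m n.
  have le : ocompl a ⊙ (p n ⊙ p m) ≼ ocompl a ⊙ (p k ⊙ p k).
    apply/ele_emulr/(ele_trans (b := p k ⊙ p m)).
      exact/ele_emull/increasing_le/leq_maxr.
    exact/ele_emulr/increasing_le/leq_maxl.
  by apply: ele_trans le _; apply: ele_osum_cancel (walk_osum (p k)) ey (pq k.+1).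
right; have [aa|aa] := pselect (ocompl a = 0); first by rewrite aa; apply: ele0x.
have p1 n : p n <> 1.
  elim: n => [|n IH] /=.
    by move=> M01; case: aa; rewrite -(emulx1 (ocompl a)) -M01 emulx0.
  move=> h; have := walk_compl (p n); rewrite h ocompl1 => /osum_eq0 h0.
  apply: aa; apply: elex0; apply: (@ele_emul_cancelr (ocompl (p n))).
    by move=> k; apply: IH; have := osum_compl (p n); rewrite k osumx0 => -[].
  by rewrite h0; apply: ele0x.
rewrite -(emulx1 (ocompl a)) -(emulx1 (_ ⊙ 1)).
rewrite -{1}q1; apply: (sup_emul pI qP) => n; rewrite emulx1.
exact: walk_ge (p1 n) (pI n).
Qed.

End Comparison.

(** Comparing [c = h ⊙ a ⊕ h ⊙ ocompl b] with its complement
    [h ⊙ ocompl a ⊕ h ⊙ b] amounts to comparing [a] with [b]. *)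
Lemma ele_total (h : M) : Some h ⊞ Some h = Some 1 ->
  forall a b, a ≼ b \/ b ≼ a.
Proof.
move=> hh; have half x : Some (h ⊙ x) ⊞ Some (h ⊙ x) = Some x.
  by rewrite (emul_suml x hh) emul1x.
(* If [x ⊕ x] is defined then [x = h ⊙ (x ⊕ x)]. *)
have le_half x : x ≼ ocompl x -> x ≼ h.
  move=> /ele_complP[y ey].
  have := emul_sumr h ey; rewrite half => -[->].
  exact: emul_ler.
have cancel a b c v : Some (h ⊙ a) ⊞ Some (h ⊙ c) = Some v -> v ≼ h ->
    Some (h ⊙ b) ⊞ Some (h ⊙ c) = Some h -> a ≼ b.
  rewrite osumC => ea vh; rewrite osumC => eb.
  have le := ele_osum_cancel ea eb vh.
  by have [w] := ele_osum2 le le (half b); rewrite half => -[->].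
have split_half x : Some (h ⊙ x) ⊞ Some (h ⊙ ocompl x) = Some h.
  exact: emul_splitr.
move=> a b.
have := hh; rewrite -{1}(split_half a) -{1}(split_half b).
rewrite [X in _ ⊞ X]osumC osumACA => e.
have [c [d [ec ed]]] := osum_defined e.
have [cc|cc] := ele_compl_total c.
  by left; apply: cancel ec (le_half _ cc) (split_half b).
right; move: e; rewrite ec ed => /osum1_compl[dc].
rewrite osumC in ed; apply: cancel ed _ (split_half a).
by apply: le_half; rewrite dc ocomplK.
Qed.

End TrivialIdempotents.

(** * Dyadic multiples and the embedding into the reals *)

(** The form in which an estimate that holds up to [1 / 2 ^ n] for all [n]
    becomes exact. *)
Lemma expr2n_archi (R : realType) (x y : R) :
  (forall n, x * 2 ^+ n <= y)%R -> (x <= 0)%R.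
Proof.
move=> xy; rewrite leNgt; apply/negP => x0.
have := archi_boundP (normr_ge0 (y / x)%R); set n := Num.bound _ => yn.
have : (y / x < 2 ^+ n)%R.
  apply: le_lt_trans (ler_norm _) (lt_le_trans yn _).
  by rewrite -natrX ler_nat ltnW // ltn_expl.
by rewrite ltr_pdivrMr // mulrC ltNge xy.
Qed.

Section Dyadic.
Variables (R : realType) (M : omegaEffectMonoidType) (h : M).
Hypotheses (hh : Some h ⊞ Some h = Some 1) (M10 : (1 : M) <> 0).
Hypothesis idem01 : forall e : M, e ⊙ e = e -> e = 0 \/ e = 1.
Implicit Types (a b c x y z : M).

(** [None] when the sum of [k] copies of [x] is not defined. *)
Definition multiple k x : option M := iter k (osum (Some x)) (Some 0).

Lemma multipleS k x : multiple k.+1 x = Some x ⊞ multiple k x. Proof. by []. Qed.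

Lemma multipleD k l x : multiple (k + l) x = multiple k x ⊞ multiple l x.
Proof.
elim: k => [|k IH]; first by rewrite osum0x.
by rewrite addSn !multipleS IH osumA.
Qed.

Lemma multiple_double k x y : Some x ⊞ Some x = Some y ->
  multiple k.*2 x = multiple k y.
Proof.
by move=> xy; elim: k => // k IH; rewrite doubleS !multipleS osumA xy IH.
Qed.

Lemma multiple_zero k : multiple k 0 = Some 0.
Proof. by elim: k => // k IH; rewrite multipleS IH osumx0. Qed.

Local Notation δ n := (epow h n).

Lemma half_epow n : Some (δ n.+1) ⊞ Some (δ n.+1) = Some (δ n).
Proof. by rewrite (emul_suml _ hh) emul1x. Qed.

Lemma multiple_epow k m n : multiple k (δ n) = multiple (2 ^ m * k) (δ (m + n)).
Proof.
elim: m => [|m IH]; first by rewrite expn0 mul1n.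
by rewrite expnS -mulnA mul2n (multiple_double _ (half_epow _)) -IH.
Qed.

Lemma multiple_full n : multiple (2 ^ n) (δ n) = Some 1.
Proof.
by have := multiple_epow 1 n 0; rewrite muln1 addn0 /multiple /= osumx0.
Qed.

Lemma epow_neq0 n : δ n <> 0.
Proof.
move=> d0; apply: M10.
by have := multiple_full n; rewrite d0 multiple_zero => -[].
Qed.

Lemma half_total a b : a ≼ b \/ b ≼ a.
Proof. exact: ele_total hh _ _. Qed.

(** The powers of [h = ocompl h] have infimum zero, so by totality one of them
    is below [a]. *)
Lemma epow_archi a : a <> 0 -> exists n, δ n ≼ a.
Proof.
move=> a0; apply: contrapT => na; apply: a0; apply: elex0.
rewrite -(ocomplK a) -(ocompl1 M); apply: ele_compl.
have hc : ocompl h = h by have [] := osum1_compl hh.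
have h0 : h <> 0 by move=> h0; apply: (@epow_neq0 1); rewrite /= h0 emul0x.
have [_] := sup_epow1 idem01 h0; apply=> n; rewrite hc; apply: ele_compl.
by have [|//] := half_total (δ n) a => dn; case: na; exists n.
Qed.

(** Bisection: pass from [δ n] to its half, and compare the remainder [z] with
    that half. *)
Lemma epow_approx n a : exists k z,
  multiple k (δ n) ⊞ Some z = Some a /\ z ≼ δ n.
Proof.
elim: n => [|n [k [z [ka zn]]]].
  by exists 0%N, a; rewrite osum0x; split=> //; apply: elex1.
rewrite -(multiple_double _ (half_epow n)) in ka.
have [le|/eleP[x ex]] := half_total z (δ n.+1); first by exists k.*2, z.
have [_ [w [_ xw]]] := osum_defined ex; rewrite {x}xw in ex.
exists k.*2.+1, w; rewrite multipleS (osumC (Some _)) -osumA ex; split=> //.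
exact: ele_osum_cancel ex (half_epow n) zn.
Qed.

(** A state is, up to its value at [1], a finitely additive probability. *)
Definition is_state (f : M -> R) : Prop := (forall a, (0 <= f a)%R) /\
  (forall a b c, Some a ⊞ Some b = Some c -> (f a + f b = f c)%R).

Section State.
Variable f : M -> R.
Hypothesis fP : is_state f.

Lemma state_le a b : a ≼ b -> (f a <= f b)%R.
Proof.
have [f0 fD] := fP; move=> [c /osumE /fD <-].
by rewrite lerDl.
Qed.

Lemma state_mult k x y : multiple k x = Some y -> (f y = k%:R * f x)%R.
Proof.
have [f0 fD] := fP; elim: k y => [|k IH] y.
  move=> [<-]; rewrite mul0r; have := fD _ _ _ (osumx0 (Some (0 : M))).
  by move=> /eqP; rewrite addrC -subr_eq0 addrK => /eqP.
rewrite multipleS => /[dup] /osum_defined[_ [w [_ ew]]]; rewrite ew => /fD <-.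
by rewrite (IH _ ew) -natr1; lra.
Qed.

Lemma state_epow n : (f (δ n) * 2 ^+ n = f 1%EA)%R.
Proof. by have := state_mult (multiple_full n) => ->; rewrite natrX mulrC. Qed.

Lemma state_approx k n z a : multiple k (δ n) ⊞ Some z = Some a -> z ≼ δ n ->
  (k%:R * f 1%EA <= f a * 2 ^+ n <= k%:R * f 1%EA + f 1%EA)%R.
Proof.
have [f0 fD] := fP; move=> /[dup] /osum_defined[w [_ [ew _]]].
rewrite ew => /fD <- /state_le le; rewrite (state_mult ew) mulrDl -mulrA.
have p2 : (0 <= 2 ^+ n :> R)%R by rewrite exprn_ge0.
have := ler_wpM2r p2 le; have := mulr_ge0 (f0 z) p2; rewrite state_epow.
by move=> u v; apply/andP; split; lra.
Qed.

End State.

(** Both [f a] and [f 1 * g a] are known up to [f 1 / 2 ^ n] from the number of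
    copies of [δ n] that fit into [a]. *)
Lemma state_unique f g : is_state f -> is_state g -> g 1 = 1%R ->
  forall a, (f a = f 1%EA * g a)%R.
Proof.
move=> fP gP g1 a.
have bound n : (`|f a - f 1%EA * g a| * 2 ^+ n <= f 1%EA)%R.
  have [k [z [ka zn]]] := epow_approx n a.
  have /andP[f_lo f_hi] := state_approx fP ka zn.
  have /andP[g_lo g_hi] := state_approx gP ka zn.
  have f10 : (0 <= f 1%EA)%R by have [] := fP.
  rewrite g1 mulr1 in g_lo g_hi.
  have u := ler_wpM2l f10 g_lo; have v := ler_wpM2l f10 g_hi.
  have p2 : (0 <= 2 ^+ n :> R)%R by rewrite exprn_ge0.
  rewrite -{1}(ger0_norm p2) -normrM ler_norml mulrBl.
  by apply/andP; split; lra.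
have := expr2n_archi bound; rewrite normr_le0 subr_eq0.
by move=> /eqP.
Qed.

(** * Existence of the state *)

Definition lower a : set R :=
  [set r | exists k n (x : option M),
    multiple k (δ n) ⊞ x = Some a /\ r = (k%:R / 2 ^+ n)%R]%classic.

Definition dyadic_state a : R := sup (lower a).

Lemma multiple_le1 k n (x : option M) :
  multiple k (δ n) ⊞ x = Some 1 -> (k <= 2 ^ n)%N.
Proof.
move=> kx; rewrite leqNgt; apply/negP => /subnK kn.
move: kx; rewrite -kn -addSnnS addnC multipleD multiple_full -osumA => /osum_idem.
by rewrite multipleS -osumA => /osum_eq0/epow_neq0.
Qed.

Lemma lower_le1 a : ubound (lower a) 1%R.
Proof.
move=> _ [k [n [x [ka ->]]]]; rewrite ler_pdivrMr ?exprn_gt0 // mul1r.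
rewrite -natrX ler_nat; apply: (@multiple_le1 _ _ (x ⊞ Some (ocompl a))).
by rewrite osumA ka osum_compl.
Qed.

Lemma lower_has_sup a : has_sup (lower a).
Proof.
split; last by exists 1%R; apply: lower_le1.
by exists 0%R, 0%N, 0%N, (Some a); rewrite osum0x mul0r.
Qed.

Lemma dyadic_state_ge a r : lower a r -> (r <= dyadic_state a)%R.
Proof. by move=> ar; apply: ub_le_sup ar; case: (lower_has_sup a). Qed.

Lemma dyadic_state1 : dyadic_state 1 = 1%R.
Proof.
apply/eqP; rewrite eq_le; apply/andP; split.
  by apply: ge_sup (@lower_le1 1); case: (lower_has_sup 1).
apply: dyadic_state_ge; exists 1%N, 0%N, (Some 0).
by rewrite /multiple /= !osumx0 expr0 divr1.
Qed.

Lemma dyadic_state_superadd a b c : Some a ⊞ Some b = Some c ->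
  (dyadic_state a + dyadic_state b <= dyadic_state c)%R.
Proof.
move=> abc; rewrite -lerBrDr; apply: ge_sup; first by case: (lower_has_sup a).
move=> r ar; rewrite lerBrDr -lerBrDl.
apply: ge_sup; first by case: (lower_has_sup b).
move=> s bs; rewrite lerBrDl; apply: dyadic_state_ge.
have [k [n [x [ka ->]]]] := ar; have [l [m [y [lb ->]]]] := bs.
exists (2 ^ m * k + 2 ^ n * l)%N, (m + n)%N, (x ⊞ y); split.
  by rewrite multipleD -multiple_epow (addnC m) -multiple_epow osumACA ka lb.
have p2 i : (2 ^+ i != 0 :> R)%R by rewrite expf_neq0 // pnatr_eq0.
by rewrite natrD !natrM !natrX exprD addf_div //; congr (_ / _)%R; lra.
Qed.

(** Approximating [a], [b] and [c] up to [δ n] accounts for all but at most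
    three of the [2 ^ n] copies of [δ n] that make up [1]. *)
Lemma dyadic_state_full a b c : Some a ⊞ Some b ⊞ Some c = Some 1 ->
  (1 <= dyadic_state a + dyadic_state b + dyadic_state c)%R.
Proof.
move=> abc; rewrite -subr_le0; apply: (@expr2n_archi _ _ 3%:R) => n.
have [k [z1 [ka z1n]]] := epow_approx n a.
have [l [z2 [lb z2n]]] := epow_approx n b.
have [j [z3 [jc z3n]]] := epow_approx n c.
have full : multiple (k + l + j) (δ n) ⊞ (Some z1 ⊞ Some z2 ⊞ Some z3) = Some 1.
  by rewrite !multipleD osumACA (osumACA (multiple k _)) ka lb jc.
have le : (2 ^ n <= k + l + j + 3)%N.
  rewrite leqNgt; apply/negP => /subnK; set r := (_ - _)%N => nr.
  have := multiple_full n; rewrite -nr -addSnnS addnC -addnA multipleD => full'.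
  have [w [_ [ew _]]] := osum_defined full; rewrite ew in full full'.
  have := osum_cancel full full'; rewrite multipleD.
  have [v ev] : exists v, Some z1 ⊞ Some z2 ⊞ Some z3 = Some v.
    by case: (osum_defined full) => _ [v [_]]; exists v.
  have [_ [t [_ et]]] := osum_defined full'.
  move: et; rewrite multipleD => /osum_defined[d [_ [ed _]]].
  have vd : v ≼ d.
    move: ed; rewrite /multiple /= osumx0 osumA.
    move=> /[dup] /osum_defined[g [_ [eg _]]].
    have [g' eg' gg'] := ele_osum2 z1n z2n eg; rewrite eg => ed.
    by have [v'] := ele_osum2 gg' z3n ed; rewrite -eg' ev => -[->].
  rewrite ev ed => e; have dv : d = v.
    by apply: ele_anti vd; apply: osum_eler (esym e).
  move: e; rewrite dv multipleS => /esym/osum_idem/osum_eq0.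
  exact: epow_neq0.
have lo : forall i x y, multiple i (δ n) ⊞ Some x = Some y ->
    (i%:R <= dyadic_state y * 2 ^+ n)%R.
  move=> i x y e; rewrite -ler_pdivrMr ?exprn_gt0 //; apply: dyadic_state_ge.
  by exists i, n, (Some x).
have := lo _ _ _ ka; have := lo _ _ _ lb; have := lo _ _ _ jc.
by move: le; rewrite -(ler_nat R) !natrD natrX; lra.
Qed.

(** [dyadic_state_superadd] bounds the value at a sum from below, and applied
    to [c] and [ocompl c] also the sum of their values from above by [1];
    [dyadic_state_full] closes the circle. *)
Lemma dyadic_stateP : is_state dyadic_state.
Proof.
split=> [a|a b c abc].
  apply: dyadic_state_ge; exists 0%N, 0%N, (Some a).
  by rewrite osum0x mul0r.
have := dyadic_state_superadd abc.
have := dyadic_state_superadd (osum_compl c); rewrite dyadic_state1.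
have := osum_compl c; rewrite -abc => /dyadic_state_full.
lra.
Qed.

(** * The state is an isomorphism *)

Local Notation f := dyadic_state.

Let f_ge0 := dyadic_stateP.1.
Let fD := dyadic_stateP.2.
Let f_epow n : (f (δ n) * 2 ^+ n = 1)%R.
Proof. by rewrite (state_epow dyadic_stateP) dyadic_state1. Qed.

Let f_epow_gt0 n : (0 < f (δ n))%R.
Proof.
rewrite lt_neqAle f_ge0 andbT eq_sym; apply/eqP => e.
by have := f_epow n; rewrite e mul0r => /eqP; rewrite eq_sym oner_eq0.
Qed.

Let f_compl a : (f (ocompl a) = 1 - f a)%R.
Proof. by have := fD (osum_compl a); rewrite dyadic_state1; lra. Qed.

Let f_le1 a : (f a <= 1)%R.
Proof. by have := f_compl a; have := f_ge0 (ocompl a); lra. Qed.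

(** By totality it is enough to exclude a nonzero difference [r = a ⊖ b] of
    value zero, and [r] is above some [δ n]. *)
Lemma dyadic_state_reflect a b : (f a <= f b)%R -> a ≼ b.
Proof.
move=> ab; have [//|/eleP[x ex]] := half_total a b.
have [_ [r [_ er]]] := osum_defined ex; rewrite {x}er in ex.
have [r0|/epow_archi[n /(state_le dyadic_stateP)]] := pselect (r = 0).
  by move: ex; rewrite r0 osumx0 => -[->]; apply: ele_refl.
by have := fD ex; have := f_epow_gt0 n; lra.
Qed.

(** The map [a |-> f (a ⊙ b)] is a state with value [f b] at [1]. *)
Lemma dyadic_state_mul a b : (f (a ⊙ b) = f a * f b)%R.
Proof.
have P : is_state (fun x => f (x ⊙ b)).
  by split=> [x|x y z /(emul_suml b)/fD].
by rewrite (state_unique P dyadic_stateP dyadic_state1 a) emul1x mulrC.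
Qed.

(** The binary expansion of [r], truncated and read in [M]: the next [δ n] is
    added whenever the value stays at most [r]. *)
Fixpoint expansion (r : R) n : M :=
  if n is n'.+1 then
    if (f (expansion r n') + f (δ n) <= r)%R then expansion r n' ⊕ δ n
    else expansion r n'
  else 0.

Lemma expansionP r n : (0 <= r <= 1)%R -> expansion r n ≼ expansion r n.+1 /\
  (f (expansion r n) <= r <= f (expansion r n) + f (δ n))%R.
Proof.
move=> /andP[r0 r1].
have step m : (f (expansion r m) <= r <= f (expansion r m) + f (δ m))%R ->
    expansion r m ≼ expansion r m.+1 /\
    (f (expansion r m.+1) <= r <= f (expansion r m.+1) + f (δ m.+1))%R.
  move=> /andP[lo hi]; have dm := fD (half_epow m); move=> /=.
  case: ifP => [le|/negbT]; last first.
    by rewrite -ltNge => lt; split; [exact: ele_refl|apply/andP; split; lra].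
  have /ele_complP[w ew] : expansion r m ≼ ocompl (δ m.+1).
    by apply: dyadic_state_reflect; rewrite f_compl; lra.
  have /osumE[_ e] := ew; rewrite /= in e; rewrite e; split.
    exact: osum_eler ew.
  by have := fD ew; rewrite /= => <-; apply/andP; split; lra.
suff inv : (f (expansion r n) <= r <= f (expansion r n) + f (δ n))%R.
  by split=> //; have [] := step n inv.
elim: n => [|n /step[]//] /=.
have /= := f_epow 0; rewrite expr0 mulr1 => ->.
by have := f_compl 1; rewrite ocompl1 dyadic_state1 => ->; apply/andP; split; lra.
Qed.

(** The supremum [s] of the truncated expansions has value at least [r].  If it
    were larger, some [δ n] could be taken away from [s] and leave a smaller
    upper bound of the truncations. *)
Lemma dyadic_state_surj (r : R) : (0 <= r <= 1)%R -> exists s, f s = r.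
Proof.
move=> r01; pose u := expansion r.
have uI : increasing u by move=> n; have [] := expansionP n r01.
have [s [us sl]] := omega_complete u uI; exists s.
apply/eqP; rewrite eq_le; apply/andP; split; last first.
  rewrite -subr_le0; apply: (@expr2n_archi _ _ 1%R) => n.
  rewrite -[leRHS](f_epow n) ler_pM2r ?exprn_gt0 //.
  have [_ /andP[_ hi]] := expansionP n r01.
  by have := state_le dyadic_stateP (us n); rewrite -/u in hi *; lra.
rewrite -subr_le0; apply: (@expr2n_archi _ _ 1%R) => n.
rewrite -[leRHS](f_epow n) ler_pM2r ?exprn_gt0 // leNgt; apply/negP => lt.
have /andP[r0 r1] := r01.
have /eleP[x] : δ n ≼ s by apply: dyadic_state_reflect; lra.
move=> /[dup] /osum_defined[_ [y [_ ->]]] /fD fs.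
suff /(state_le dyadic_stateP) : s ≼ y by have := f_epow_gt0 n; lra.
apply: sl => m; apply: dyadic_state_reflect.
by have [_ /andP[lo _]] := expansionP m r01; rewrite -/u in lo; lra.
Qed.

Lemma dyadic_iso : emonoid_iso M (unitI R).
Proof.
have fI a : (0 <= f a <= 1)%R by rewrite f_ge0 f_le1.
pose F a := UnitI (fI a).
have surj (r : unitI R) : exists a, F a = r.
  have [a fa] := dyadic_state_surj (unitI_bound r).
  by exists a; apply: unitI_inj.
have [G GK] := choice surj.
have refl a b : F a ⊥ F b -> a ⊥ b.
  rewrite /orth /= /unitI_orth /= -f_compl => /dyadic_state_reflect.
  by move=> /ele_complP[c /osumE[]].
have FK : cancel F G.
  move=> a; have e : f (G (F a)) = f a.
    by have := congr1 (@unitI_val R) (GK (F a)).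
  by apply: ele_anti; apply: dyadic_state_reflect; rewrite e.
apply: (bij_emonoid_iso _ refl FK GK).
split; last first.
  by move=> a b; apply: unitI_inj; apply: dyadic_state_mul.
split=> [|a b ab].
  by apply: unitI_inj; rewrite /= dyadic_state1 subr0.
have e := fD (osum_orth ab).
have FF : unitI_orth (F a) (F b).
  by rewrite /unitI_orth /=; have := f_le1 (a ⊕ b); lra.
by split=> //; apply: unitI_inj; rewrite [RHS]unitI_oplusE.
Qed.

End Dyadic.

(** * The unit interval and the two-element monoid *)

Lemma unitI_not_final (R : realType) : ~ is_final (unitI R).
Proof.
move=> /final_trivial/(congr1 (@unitI_val R)) /= /eqP.
by rewrite subr0 oner_eq0.
Qed.

(** In [bool] nothing plays the role of one half. *)
Lemma unitI_not_initial (R : realType) : ~ is_initial (unitI R).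
Proof.
move=> /(_ bool)[g [[[[g1 gD] _] _] _]].
have hI : (0 <= (2^-1 : R) <= 1)%R by lra.
have hh : (UnitI hI ⊥ UnitI hI)%EA by rewrite /orth /= /unitI_orth /=; lra.
have e : UnitI hI ⊕ UnitI hI = 1.
  by apply: unitI_inj; rewrite [LHS]unitI_oplusE //=; lra.
have [] := gD _ _ hh; rewrite e g1 /orth /oplus /=.
by case: (g (UnitI hI)).
Qed.

(** A decomposition of a monoid gives the idempotent corresponding to
    [(1, 0)]; in the unit interval the only idempotents are [0] and [1]. *)
Lemma unitI_irreducible (R : realType) : is_irreducible (unitI R).
Proof.
move=> M1 M2 [f [g [[[f1 _] _] [gh gM] fK gK]]].
pose p : M1 * M2 := (1, 0).
have pp : p ⊙ p = p by congr (_, _); [apply: emulx1 | apply: emulx0].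
have := gM p p; rewrite pp => /(congr1 (@unitI_val R)) /= e.
have : (unitI_val (g p) * (1 - unitI_val (g p)) == 0)%R.
  by rewrite mulrBr mulr1 -e subrr.
rewrite mulf_eq0 => /orP[/eqP z|/eqP z].
  left; apply: trivial_final.
  have gp : g p = 0 by apply: unitI_inj.
  by have := gK p; rewrite gp -(ea_hom0 gh) gK => -[].
right; apply: trivial_final.
have gp : g p = 1 by apply: unitI_inj => /=; lra.
by have := gK p; rewrite gp f1 => -[].
Qed.

(** The only candidate is [0 |-> 0], [1 |-> 1].  It preserves suprema because
    an increasing sequence with supremum [1] takes the value [1]. *)
Lemma two_elements_initial (M : omegaEffectMonoidType) :
  (1 : M) <> 0 -> (forall a : M, a = 0 \/ a = 1) -> is_initial M.
Proof.
move=> M10 M01 N; pose f (a : M) : N := if pselect (a = 0) then 0 else 1.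
have f0 : f 0 = 0 by rewrite /f; case: pselect.
have f1 : f 1%EA = 1 by rewrite /f; case: pselect.
exists f; split; last first.
  move=> g [[gh _] _]; apply/funext => a.
  have [->|->] := M01 a; first by rewrite (ea_hom0 gh) f0.
  by case: gh => -> _; rewrite f1.
split.
  split; last first.
    by move=> a b; have [->|->] := M01 a;
      rewrite ?emul0x ?emul1x ?f0 ?f1 ?emul0x ?emul1x.
  split=> // a b /osum_orth; set c := a ⊕ b => abc.
  suff /osumE[? <-] : Some (f a) ⊞ Some (f b) = Some (f c) by [].
  move: abc; have [->|->] := M01 a; first by rewrite f0 !osum0x => -[->].
  have [->|->] := M01 b; first by rewrite f0 !osumx0 => -[->].
  by move=> /osumE[/orth_one].
move=> u s uI [us sl]; have [s0|s1] := M01 s.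
  have u0 n : u n = 0 by apply: elex0; rewrite -s0.
  split=> [n|b /(_ 0%N)]; last by rewrite u0 s0.
  by rewrite u0 s0; apply: ele_refl.
split=> [n|b ub]; first by rewrite s1 f1; apply: elex1.
have [n un] : exists n, u n = 1.
  apply: contrapT => nu; apply: M10; rewrite -s1; apply: elex0; apply: sl => n.
  have [->|un] := M01 (u n); first exact: ele_refl.
  by case: nu; exists n.
by have := ub n; rewrite un s1.
Qed.

Theorem theorem36 (R : realType) :
  [/\ ~ is_initial (unitI R), ~ is_final (unitI R)
    & is_irreducible (unitI R)] /\
  (forall M : omegaEffectMonoidType,
     ~ is_initial M -> ~ is_final M -> is_irreducible M ->
     emonoid_iso M (unitI R)).
Proof.
split.
  split; [exact: unitI_not_initial | exact: unitI_not_final |].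
  exact: unitI_irreducible.
move=> M ninit nfin irr.
have idem01 (e : M) : e ⊙ e = e -> e = 0 \/ e = 1 by apply: irreducible_idem.
have M10 : (1 : M) <> 0 by move=> /trivial_final.
have [a [a0 a1]] : exists a : M, a <> 0 /\ a <> 1.
  apply: contrapT => na; apply: ninit; apply: two_elements_initial => // a.
  have [|a0] := pselect (a = 0); first by left.
  by right; apply: contrapT => a1; apply: na; exists a.
have [h hh] := half_exists idem01 a0 a1.
exact: dyadic_iso hh M10 idem01.
Qed.
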